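(* Let $k$ be an algebraically closed field of characteristic $p>3$, let $\mathfrak{g}=W_1$ be the Witt algebra over $k$, and let $\mathscr{N}=\{x\in\mathfrak{g}\mid x^{[p]}=0\}$ be its nilpotent variety. Then the nilpotent commuting variety $\mathscr{C}(\mathscr{N})=\{(x,y)\in\mathscr{N}\times\mathscr{N}\mid [x,y]=0\}$ is not normal.
   Context: Let $\mathfrak{A}=k[X]/(X^p)$ and let $D$ be the derivation of $\mathfrak{A}$ with $D(X^i)=iX^{i-1}$ for $0\le i\le p-1$. The Witt algebra $W_1$ is the Lie algebra of $k$-linear derivations of $\mathfrak{A}$, with basis $X^iD$, $0\le i\le p-1$; it is a restricted Lie algebra whose $[p]$-map is the $p$-th power of derivations as linear operators. $\mathscr{C}(\mathscr{N})$ is regarded as a variety, i.e. a Zariski closed subset of the affine space $\mathfrak{g}\times\mathfrak{g}$ with its reduced structure. A (possibly reducible) variety is normal if all its local rings are integrally closed domains. *)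

(* Defs.v *)
From HB Require Import structures.
From mathcomp Require Import all_boot all_order all_algebra.
From mathcomp Require Import boolp.
From mathcomp Require Import mpoly ring.

Set Implicit Arguments.
Unset Strict Implicit.
Unset Printing Implicit Defensive.

Import GRing.Theory.
Local Open Scope ring_scope.
Local Open Scope quotient_scope.

Definition integrally_closed (R : idomainType) : Prop :=
  forall u : {fraction R},
    integralOver (@tofrac R) u -> exists a : R, u = tofrac a.

(* A comNzRingType carries no idomainType structure of its own, so "A is an
   integrally closed domain" is stated up to isomorphism. *)
Definition integrally_closed_domain (A : comNzRingType) : Prop :=
  exists (R : idomainType) (f : {rmorphism A -> R}),
    bijective f /\ integrally_closed R.

(* Localization of R at the prime ideal ker phi, for phi a morphism to a
   field: fractions a/s with phi s <> 0, where a/s = b/t iff u(at - bs) = 0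
   for some u outside ker phi. *)
Section Localization.
Variables (R : comPzRingType) (F : fieldType) (phi : {rmorphism R -> F}).

Record prefrac := Prefrac {
  prefrac_val :> R * R;
  _ : phi prefrac_val.2 != 0
}.
HB.instance Definition _ := [isSub for prefrac_val].
HB.instance Definition _ := [Choice of prefrac by <:].
Implicit Types x y z : prefrac.

Lemma prefracP x : phi x.2 != 0. Proof. by case: x. Qed.

Definition equiv_loc : rel prefrac := fun x y =>
  `[< exists u : R, phi u != 0 /\ u * (x.1 * y.2 - y.1 * x.2) = 0 >].

Lemma equiv_locP x y :
  reflect (exists u : R, phi u != 0 /\ u * (x.1 * y.2 - y.1 * x.2) = 0)
          (equiv_loc x y).
Proof. exact: asboolP. Qed.

Lemma eq_equiv_loc x y : x.1 * y.2 = y.1 * x.2 -> equiv_loc x y.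
Proof.
move=> e; apply/equiv_locP; exists 1.
by rewrite rmorph1 oner_neq0 e subrr mulr0.
Qed.

Lemma equiv_loc_is_equiv : equiv_class_of equiv_loc.
Proof.
have sym x y : equiv_loc x y -> equiv_loc y x.
  move=> /equiv_locP[u [pu e]]; apply/equiv_locP; exists u; split=> //.
  by rewrite -opprB mulrN e oppr0.
split=> [x|x y|y x z]; first exact: eq_equiv_loc.
  by apply/idP/idP; apply: sym.
move=> /equiv_locP[u [pu eu]] /equiv_locP[v [pv ev]]; apply/equiv_locP.
exists (u * v * y.2); split; first by rewrite !rmorphM !mulf_neq0 ?prefracP.
have -> : u * v * y.2 * (x.1 * z.2 - z.1 * x.2)
  = v * z.2 * (u * (x.1 * y.2 - y.1 * x.2))
    + u * x.2 * (v * (y.1 * z.2 - z.1 * y.2)) by ring.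
by rewrite eu ev !mulr0 addr0.
Qed.

Canonical equiv_loc_equiv := EquivRelPack equiv_loc_is_equiv.
Canonical equiv_loc_encModRel := defaultEncModRel equiv_loc.

Definition localization := {eq_quot equiv_loc}.
HB.instance Definition _ : EqQuotient prefrac equiv_loc localization :=
  EqQuotient.on localization.
HB.instance Definition _ := Choice.on localization.

Lemma pi_locP x y : reflect (\pi_localization x = \pi y) (equiv_loc x y).
Proof. by apply: (iffP idP) => [|/eqmodP //] h; apply/eqmodP. Qed.

Lemma equiv_loc_repr x : equiv_loc x (repr (\pi_localization x)).
Proof. by apply/pi_locP; rewrite reprK. Qed.

Fact phi1_neq0 : phi 1 != 0. Proof. by rewrite rmorph1 oner_neq0. Qed.

Fact phiM_neq0 x y : phi (x.2 * y.2) != 0.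
Proof. by rewrite rmorphM mulf_neq0 ?prefracP. Qed.

Definition cst_pre (a : R) : prefrac := @Prefrac (a, 1) phi1_neq0.
Definition opp_pre x : prefrac := @Prefrac (- x.1, x.2) (prefracP x).
Definition add_pre x y : prefrac :=
  @Prefrac (x.1 * y.2 + y.1 * x.2, x.2 * y.2) (phiM_neq0 x y).
Definition mul_pre x y : prefrac :=
  @Prefrac (x.1 * y.1, x.2 * y.2) (phiM_neq0 x y).

Definition loc_zero : localization := lift_cst localization (cst_pre 0).
Definition loc_one : localization := lift_cst localization (cst_pre 1).
Definition loc_opp := lift_op1 localization opp_pre.
Definition loc_add := lift_op2 localization add_pre.
Definition loc_mul := lift_op2 localization mul_pre.

Canonical pi_loc_zero := PiConst loc_zero.
Canonical pi_loc_one := PiConst loc_one.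

Lemma pi_opp : {morph \pi_localization : x / opp_pre x >-> loc_opp x}.
Proof.
move=> x; unlock loc_opp; apply/pi_locP/equiv_locP => /=.
have /equiv_locP[u [pu e]] := equiv_loc_repr x.
by exists u; split=> //; rewrite !mulNr -opprD mulrN e oppr0.
Qed.
Canonical pi_loc_opp := PiMorph1 pi_opp.

Lemma pi_add : {morph \pi_localization : x y / add_pre x y >-> loc_add x y}.
Proof.
move=> x y; unlock loc_add; apply/pi_locP/equiv_locP => /=.
have /equiv_locP[u [pu eu]] := equiv_loc_repr x.
have /equiv_locP[v [pv ev]] := equiv_loc_repr y.
exists (u * v); split; first by rewrite rmorphM mulf_neq0.
move: (repr (\pi x)) (repr (\pi y)) eu ev => x' y' eu ev.
transitivity (v * y.2 * y'.2 * (u * (x.1 * x'.2 - x'.1 * x.2))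
  + u * x.2 * x'.2 * (v * (y.1 * y'.2 - y'.1 * y.2))); first by ring.
by rewrite eu ev !mulr0 addr0.
Qed.
Canonical pi_loc_add := PiMorph2 pi_add.

Lemma pi_mul : {morph \pi_localization : x y / mul_pre x y >-> loc_mul x y}.
Proof.
move=> x y; unlock loc_mul; apply/pi_locP/equiv_locP => /=.
have /equiv_locP[u [pu eu]] := equiv_loc_repr x.
have /equiv_locP[v [pv ev]] := equiv_loc_repr y.
exists (u * v); split; first by rewrite rmorphM mulf_neq0.
move: (repr (\pi x)) (repr (\pi y)) eu ev => x' y' eu ev.
transitivity (v * y.1 * y'.2 * (u * (x.1 * x'.2 - x'.1 * x.2))
  + u * x.2 * x'.1 * (v * (y.1 * y'.2 - y'.1 * y.2))); first by ring.
by rewrite eu ev !mulr0 addr0.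
Qed.
Canonical pi_loc_mul := PiMorph2 pi_mul.

Lemma loc_addA : associative loc_add.
Proof.
elim/quotW=> x; elim/quotW=> y; elim/quotW=> z; rewrite !piE.
by apply/pi_locP/eq_equiv_loc => /=; ring.
Qed.

Lemma loc_addC : commutative loc_add.
Proof.
elim/quotW=> x; elim/quotW=> y; rewrite !piE.
by apply/pi_locP/eq_equiv_loc => /=; ring.
Qed.

Lemma loc_add0 : left_id loc_zero loc_add.
Proof.
elim/quotW=> x; rewrite !piE.
by apply/pi_locP/eq_equiv_loc => /=; ring.
Qed.

Lemma loc_addN : left_inverse loc_zero loc_opp loc_add.
Proof.
elim/quotW=> x; rewrite !piE.
by apply/pi_locP/eq_equiv_loc => /=; ring.
Qed.

HB.instance Definition _ :=
  GRing.isZmodule.Build localization loc_addA loc_addC loc_add0 loc_addN.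

Lemma loc_mulA : associative loc_mul.
Proof.
elim/quotW=> x; elim/quotW=> y; elim/quotW=> z; rewrite !piE.
by apply/pi_locP/eq_equiv_loc => /=; ring.
Qed.

Lemma loc_mulC : commutative loc_mul.
Proof.
elim/quotW=> x; elim/quotW=> y; rewrite !piE.
by apply/pi_locP/eq_equiv_loc => /=; ring.
Qed.

Lemma loc_mul1 : left_id loc_one loc_mul.
Proof.
elim/quotW=> x; rewrite !piE.
by apply/pi_locP/eq_equiv_loc => /=; ring.
Qed.

Lemma loc_mulD : left_distributive loc_mul +%R.
Proof.
elim/quotW=> x; elim/quotW=> y; elim/quotW=> z.
rewrite /GRing.add /= !piE.
by apply/pi_locP/eq_equiv_loc => /=; ring.
Qed.

Lemma loc_one_neq0 : loc_one != 0.
Proof.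
apply/eqP; rewrite /GRing.zero /= !piE => /pi_locP/equiv_locP[u [pu]] /=.
by rewrite mul0r subr0 !mulr1 => u0; rewrite u0 rmorph0 eqxx in pu.
Qed.

HB.instance Definition _ := GRing.Zmodule_isComNzRing.Build localization
  loc_mulA loc_mulC loc_mul1 loc_mulD loc_one_neq0.

End Localization.

(* Subsets V of the affine space k^n, whose points are row vectors. *)
Section AffineVariety.
Variables (k : fieldType) (n : nat).
Implicit Types (V : 'rV[k]_n -> Prop) (f g : {mpoly k[n]}).

Definition evalp (x : 'rV[k]_n) f : k := f.@[fun i => x 0 i].

Lemma evalp0 x : evalp x 0 = 0. Proof. exact: meval0. Qed.
Lemma evalp1 x : evalp x 1 = 1. Proof. exact: meval1. Qed.
Lemma evalpB x f g : evalp x (f - g) = evalp x f - evalp x g.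
Proof. exact: mevalB. Qed.
Lemma evalpM x f g : evalp x (f * g) = evalp x f * evalp x g.
Proof. exact: mevalM. Qed.

Definition zariski_closed V : Prop :=
  exists S : {mpoly k[n]} -> Prop,
    forall x, V x <-> forall f, S f -> evalp x f = 0.

Definition vanishing V : {pred {mpoly k[n]}} :=
  fun f => `[< forall x, V x -> evalp x f = 0 >].

Lemma vanishingP V f :
  reflect (forall x, V x -> evalp x f = 0) (f \in vanishing V).
Proof. exact: asboolP. Qed.

Lemma vanishing_zmod V : zmod_closed (vanishing V).
Proof.
split=> [|f g /vanishingP f0 /vanishingP g0]; apply/vanishingP=> x Vx.
  exact: evalp0.
by rewrite evalpB f0 // g0 // subrr.
Qed.
HB.instance Definition _ V :=
  GRing.isZmodClosed.Build {mpoly k[n]} (vanishing V) (vanishing_zmod V).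

Lemma vanishingM V f g : g \in vanishing V -> f * g \in vanishing V.
Proof.
by move=> /vanishingP g0; apply/vanishingP=> x Vx; rewrite evalpM g0 ?mulr0.
Qed.

(* The coordinate ring k[X_1, ..., X_n]/I(V). The library's ring structure on
   quotients requires a proper ideal, whereas V may be empty here; hence the
   ring operations are redefined on the quotient group. *)
Section CoordRing.
Variable V : 'rV[k]_n -> Prop.

Definition coord_ring := Quotient.quot (vanishing V).
HB.instance Definition _ := GRing.Zmodule.on coord_ring.
HB.instance Definition _ := EqQuotient.on coord_ring.

Lemma pi_coordP f g :
  reflect (\pi_coord_ring f = \pi g) (f - g \in vanishing V).
Proof. by rewrite Quotient.idealrBE; apply: eqP. Qed.

Definition coord_one : coord_ring := lift_cst coord_ring 1.
Definition coord_mul := lift_op2 coord_ring *%R.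

Canonical pi_coord_one := PiConst coord_one.

Lemma pi_coord_mul_subproof :
  {morph \pi_coord_ring : f g / f * g >-> coord_mul f g}.
Proof.
move=> f g; unlock coord_mul; apply/pi_coordP.
have hf : f - repr (\pi_coord_ring f) \in vanishing V.
  by apply/pi_coordP; rewrite reprK.
have hg : g - repr (\pi_coord_ring g) \in vanishing V.
  by apply/pi_coordP; rewrite reprK.
move: (repr (\pi f)) (repr (\pi g)) hf hg => f' g' hf hg.
have -> : f * g - f' * g' = g * (f - f') + f' * (g - g') by ring.
by rewrite rpredD ?vanishingM.
Qed.
Canonical pi_coord_mul := PiMorph2 pi_coord_mul_subproof.

Lemma coord_mulA : associative coord_mul.
Proof.
by elim/quotW=> f; elim/quotW=> g; elim/quotW=> h; rewrite !piE mulrA.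
Qed.

Lemma coord_mulC : commutative coord_mul.
Proof. by elim/quotW=> f; elim/quotW=> g; rewrite !piE mulrC. Qed.

Lemma coord_mul1 : left_id coord_one coord_mul.
Proof. by elim/quotW=> f; rewrite !piE mul1r. Qed.

Lemma coord_mulD : left_distributive coord_mul +%R.
Proof.
elim/quotW=> f; elim/quotW=> g; elim/quotW=> h.
by apply/eqP; rewrite piE /= mulrDl Quotient.equivE subrr rpred0.
Qed.

HB.instance Definition _ := GRing.Zmodule_isComPzRing.Build coord_ring
  coord_mulA coord_mulC coord_mul1 coord_mulD.

Variable x : {x : 'rV[k]_n | V x}.

Definition coord_eval (u : coord_ring) : k := evalp (sval x) (repr u).

Lemma coord_eval_pi f : coord_eval (\pi_coord_ring f) = evalp (sval x) f.
Proof.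
have /vanishingP/(_ _ (svalP x)) :
    repr (\pi_coord_ring f) - f \in vanishing V.
  by apply/pi_coordP; rewrite reprK.
by rewrite evalpB => /eqP; rewrite subr_eq0 => /eqP.
Qed.

Fact coord_eval_is_zmod_morphism : zmod_morphism coord_eval.
Proof.
elim/quotW=> f; elim/quotW=> g.
have -> : \pi_coord_ring f - \pi_coord_ring g = \pi_coord_ring (f - g).
  by rewrite !piE.
by rewrite !coord_eval_pi evalpB.
Qed.
Fact coord_eval_is_monoid_morphism : monoid_morphism coord_eval.
Proof.
split=> [|u v].
  have -> : 1 = \pi_coord_ring 1 by rewrite piE.
  by rewrite coord_eval_pi evalp1.
elim/quotW: u => f; elim/quotW: v => g.
have -> : \pi_coord_ring f * \pi_coord_ring g = \pi_coord_ring (f * g).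
  by rewrite !piE.
by rewrite !coord_eval_pi evalpM.
Qed.
HB.instance Definition _ :=
  GRing.isZmodMorphism.Build coord_ring k coord_eval
    coord_eval_is_zmod_morphism.
HB.instance Definition _ :=
  GRing.isMonoidMorphism.Build coord_ring k coord_eval
    coord_eval_is_monoid_morphism.

Definition local_ring : comNzRingType := localization coord_eval.

End CoordRing.

Definition normal_variety V : Prop :=
  forall x : {x : 'rV[k]_n | V x}, integrally_closed_domain (local_ring x).

End AffineVariety.

Section WittAlgebra.
Variables (k : fieldType) (p : nat).

(* {poly %/ 'X^p} is represented by the polynomials of degree < p. *)
Definition truncated_poly := {poly %/ ('X^p : {poly k})}.
Local Notation A := truncated_poly.
HB.instance Definition _ := GRing.ComUnitAlgebra.on A.
HB.instance Definition _ := Vector.on A.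
Local Notation X := ('qX : A).

(* Applied to the representative of degree < p, formal differentiation gives
   D(X^i) = i X^(i-1) for i <= p - 1. *)
Definition Dfun (q : A) : A := in_qpoly 'X^p (q : {poly k})^`().

Fact Dfun_is_linear : linear Dfun.
Proof. by move=> a q r; rewrite /Dfun /= derivD derivZ in_qpolyD in_qpolyZ. Qed.
HB.instance Definition _ := GRing.isLinear.Build k A A *:%R Dfun Dfun_is_linear.

Definition XDfun (i : nat) (q : A) : A := X ^+ i * Dfun q.

Fact XDfun_is_linear i : linear (XDfun i).
Proof. by rewrite /XDfun => a q r; rewrite linearP mulrDr scalerAr. Qed.
HB.instance Definition _ i := GRing.isLinear.Build k A A *:%R
  (XDfun i) (XDfun_is_linear i).

Definition XD (i : nat) : 'End(A) := linfun (XDfun i).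

Definition witt_algebra (d : 'End(A)) : Prop :=
  forall a b : A, d (a * b) = d a * b + a * d b.

Definition bracket (d e : 'End(A)) : 'End(A) := ((d \o e) - (e \o d))%VF.

Definition p_map (d : 'End(A)) : 'End(A) :=
  iter p (fun e => (d \o e)%VF) \1%VF.

Definition nilpotent_variety (d : 'End(A)) : Prop :=
  witt_algebra d /\ p_map d = 0.

Definition nilpotent_commuting_variety (de : 'End(A) * 'End(A)) : Prop :=
  [/\ nilpotent_variety de.1, nilpotent_variety de.2
    & bracket de.1 de.2 = 0].

Definition of_coords (v : 'rV[k]_p) : 'End(A) := \sum_(i < p) v 0 i *: XD i.

Definition pair_of_coords (v : 'rV[k]_(p + p)) : 'End(A) * 'End(A) :=
  (of_coords (lsubmx v), of_coords (rsubmx v)).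

(* C(N) in the affine space g x g = k^(2p), with respect to the basis X^i D of
   g = W_1 (see of_coords_inj and witt_algebraP). *)
Definition nilpotent_commuting_locus (v : 'rV[k]_(p + p)) : Prop :=
  nilpotent_commuting_variety (pair_of_coords v).

Section Coordinates.
Hypothesis pchar_k : p \in [pchar k].

Let p_gt1 : (1 < p)%N. Proof. exact/prime_gt1/(pcharf_prime pchar_k). Qed.
Let p_gt0 : (0 < p)%N. Proof. exact: ltnW. Qed.

Fact mk_monicXp : mk_monic ('X^p : {poly k}) = 'X^p.
Proof. by rewrite mk_monic_Xn prednK. Qed.

Fact size_mk_monicXp : (size (mk_monic ('X^p : {poly k}))).-1 = p.
Proof. by rewrite mk_monicXp size_polyXn. Qed.

Fact val_in_qpoly (f : {poly k}) :
  in_qpoly 'X^p f = f %% 'X^p :> {poly k}.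
Proof.
rewrite /= mk_monicXp Pdiv.IdomainMonic.modpE //.
exact: monicXn.
Qed.

Fact in_qpolyK (a : A) : in_qpoly 'X^p a = a.
Proof. by apply/val_inj/in_qpoly_small/size_mk_monic. Qed.

Fact Dfun_in_qpoly (f : {poly k}) :
  Dfun (in_qpoly 'X^p f) = in_qpoly 'X^p f^`().
Proof.
rewrite /Dfun val_in_qpoly [in RHS](divp_eq f 'X^p).
rewrite derivD derivM derivXn -mulr_natr.
have -> : p%:R = 0 :> {poly k} by rewrite -polyC_natr (pcharf0 pchar_k).
rewrite !mulr0 addr0 in_qpolyD -[LHS]add0r; congr (_ + _).
by apply/val_inj/esym; apply: etrans (val_in_qpoly _) (modp_mull _ _).
Qed.

Fact Dfun_leibniz (a b : A) : Dfun (a * b) = Dfun a * b + a * Dfun b.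
Proof.
have -> : a * b = in_qpoly 'X^p ((a : {poly k}) * (b : {poly k})).
  by rewrite in_qpolyM !in_qpolyK.
by rewrite Dfun_in_qpoly derivM in_qpolyD !in_qpolyM !in_qpolyK.
Qed.

Fact DfunX : Dfun X = 1.
Proof. by rewrite Dfun_in_qpoly derivX in_qpoly1. Qed.

Fact of_coordsE (v : 'rV[k]_p) (a : A) :
  of_coords v a = (\sum_(i < p) v 0 i *: X ^+ i) * Dfun a.
Proof.
rewrite /of_coords sum_lfunE mulr_suml; apply: eq_bigr => i _.
by rewrite scale_lfunE lfunE /= /XDfun scalerAl.
Qed.

Fact qX_basis (a : A) : a = \sum_(i < p) (a : {poly k})`_i *: X ^+ i.
Proof.
rewrite -[LHS]in_qpolyK -[X in in_qpoly _ X](coefK (a : {poly k})).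
have le_ap : (size (a : {poly k}) <= p)%N.
  by rewrite -[X in (_ <= X)%N]size_mk_monicXp size_npoly.
rewrite poly_def (big_ord_widen p (fun i => (a : {poly k})`_i *: 'X^i)) //.
rewrite big_mkcond raddf_sum; apply: eq_bigr => i _ /=.
case: ltnP => [_|le_ai]; last by rewrite nth_default ?scale0r ?in_qpoly0.
by rewrite in_qpolyZ rmorphXn.
Qed.

Fact coef_qX_sum (v : 'rV[k]_p) (j : 'I_p) :
  ((\sum_(i < p) v 0 i *: X ^+ i : A) : {poly k})`_j = v 0 j.
Proof.
have -> : \sum_(i < p) v 0 i *: X ^+ i
    = in_qpoly 'X^p (\sum_(i < p) v 0 i *: 'X^i).
  rewrite raddf_sum; apply: eq_bigr => i _ /=.
  by rewrite in_qpolyZ rmorphXn.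
rewrite val_in_qpoly modp_small; last first.
  rewrite size_polyXn ltnS; apply: (leq_trans (size_sum _ _ _)).
  apply/bigmax_leqP => i _; apply: (leq_trans (size_scale_leq _ _)).
  by rewrite size_polyXn.
rewrite coef_sum (bigD1 j) //= coefZ coefXn eqxx mulr1 big1 ?addr0 // => i ne.
by rewrite coefZ coefXn eq_sym (inj_eq val_inj) (negPf ne) mulr0.
Qed.

Lemma of_coords_inj : injective of_coords.
Proof.
move=> v w /(congr1 (fun d : 'End(A) => d X)).
rewrite !of_coordsE DfunX !mulr1 => e; apply/rowP => j.
by rewrite -[LHS]coef_qX_sum e coef_qX_sum.
Qed.

Lemma witt_algebraP (d : 'End(A)) :
  witt_algebra d <-> exists v, d = of_coords v.
Proof.
split=> [dD|[v ->] a b]; last first.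
  by rewrite !of_coordsE Dfun_leibniz; ring.
have d1 : d 1 = 0.
  have := dD 1 1; rewrite !mulr1 mul1r => /eqP.
  by rewrite -subr_eq subrr eq_sym => /eqP.
have dX i : d (X ^+ i) = d X * Dfun (X ^+ i).
  elim: i => [|i IH].
    rewrite !expr0 d1; have := Dfun_leibniz 1 1.
    rewrite !mulr1 mul1r => /eqP.
    by rewrite -subr_eq subrr eq_sym => /eqP ->; rewrite mulr0.
  by rewrite exprS dD Dfun_leibniz DfunX IH; ring.
exists (\row_i (d X : {poly k})`_i); apply/lfunP => a.
rewrite of_coordsE.
under eq_bigr => i _ do rewrite mxE.
rewrite -qX_basis [a in LHS]qX_basis [a in RHS]qX_basis !linear_sum mulr_sumr.
by apply: eq_bigr => i _; rewrite !linearZ /= dX scalerAr.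
Qed.

Section Closedness.
Variable n : nat.
Implicit Types (F : 'rV[k]_n -> k) (G : 'rV[k]_n -> A).
Implicit Types (u v : 'rV[k]_n -> 'rV[k]_p).

Definition polyfun F := exists f : {mpoly k[n]}, forall x, F x = evalp x f.
Definition qpolyfun G := forall j, polyfun (fun x => (G x : {poly k})`_j).

Fact polyfun_mul F1 F2 :
  polyfun F1 -> polyfun F2 -> polyfun (fun x => F1 x * F2 x).
Proof.
by move=> [f1 e1] [f2 e2]; exists (f1 * f2) => x; rewrite evalpM e1 e2.
Qed.

Fact polyfun_cst c : polyfun (fun=> c).
Proof. by exists c%:MP => x; rewrite /evalp mevalC. Qed.

Fact polyfun_sum m (F : 'I_m -> 'rV[k]_n -> k) :
  (forall i, polyfun (F i)) -> polyfun (fun x => \sum_i F i x).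
Proof.
move=> /choice[f e]; exists (\sum_i f i) => x.
by rewrite /evalp raddf_sum; apply: eq_bigr => i _; exact: e.
Qed.

Fact qpolyfun_of_coords u G :
  (forall i, polyfun (fun x => u x 0 i)) -> qpolyfun G ->
  qpolyfun (fun x => of_coords (u x) (G x)).
Proof.
move=> hu hG j.
have e x : ((of_coords (u x) (G x) : A) : {poly k})`_j =
    \sum_(i < p) \sum_(m < p)
      u x 0 i * ((G x : {poly k})`_m * (XD i (X ^+ m) : {poly k})`_j).
  rewrite /of_coords sum_lfunE poly_of_qpoly_sum coef_sum.
  apply: eq_bigr => i _; rewrite scale_lfunE poly_of_qpolyZ coefZ -mulr_sumr.
  rewrite [G x in LHS]qX_basis linear_sum poly_of_qpoly_sum coef_sum.
  congr (_ * _); apply: eq_bigr => m _.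
  by rewrite linearZ coefZ.
have [f ef] : polyfun (fun x => \sum_(i < p) \sum_(m < p)
    u x 0 i * ((G x : {poly k})`_m * (XD i (X ^+ m) : {poly k})`_j)).
  apply: polyfun_sum => i; apply: polyfun_sum => m.
  by do 2 ?apply: polyfun_mul => //; exact: polyfun_cst.
by exists f => x; rewrite e.
Qed.

Fact qpolyfun_p_map u (a : A) :
  (forall i, polyfun (fun x => u x 0 i)) ->
  qpolyfun (fun x => p_map (of_coords (u x)) a).
Proof.
move=> hu; suff h m : qpolyfun (fun x =>
    iter m (fun e => (of_coords (u x) \o e)%VF) \1%VF a) by exact: h.
elim: m => [|m IH] j.
  by exists ((a : {poly k})`_j)%:MP => x; rewrite /evalp mevalC /= id_lfunE.
have [f ef] := qpolyfun_of_coords hu IH j.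
by exists f => x; rewrite -ef /= comp_lfunE.
Qed.

Fact qpolyfun_bracket u v (a : A) :
  (forall i, polyfun (fun x => u x 0 i)) ->
  (forall i, polyfun (fun x => v x 0 i)) ->
  qpolyfun (fun x => bracket (of_coords (u x)) (of_coords (v x)) a).
Proof.
move=> hu hv j.
have ha : qpolyfun (fun=> a) by move=> i; exact: polyfun_cst.
have [f ef] := qpolyfun_of_coords hu (qpolyfun_of_coords hv ha) j.
have [g eg] := qpolyfun_of_coords hv (qpolyfun_of_coords hu ha) j.
exists (f - g) => x; rewrite evalpB -ef -eg -coefB.
by rewrite /bracket add_lfunE opp_lfunE !comp_lfunE.
Qed.

End Closedness.

Lemma nilpotent_commuting_locus_closed :
  zariski_closed nilpotent_commuting_locus.
Proof.
exists (fun f => f \in vanishing nilpotent_commuting_locus) => x.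
split=> [Vx f /vanishingP|Vx]; first exact.
have zero (d : 'rV[k]_(p + p) -> 'End(A)) :
    (forall a, qpolyfun (fun y => d y a)) ->
    (forall y, nilpotent_commuting_locus y -> d y = 0) -> d x = 0.
  move=> hd d0; apply/lfunP => a; apply/val_inj/polyP => j.
  have [f ef] := hd a j; rewrite lfunE [RHS]coef0 [LHS]ef; apply/Vx.
  by apply/vanishingP => y /d0 dy; rewrite -ef dy lfunE coef0.
have hl i : polyfun (fun y : 'rV[k]_(p + p) => lsubmx y 0 i).
  by exists 'X_(lshift p i) => y; rewrite /evalp mevalXU mxE.
have hr i : polyfun (fun y : 'rV[k]_(p + p) => rsubmx y 0 i).
  by exists 'X_(rshift p i) => y; rewrite /evalp mevalXU mxE.
split; first split.
- by apply/witt_algebraP; exists (lsubmx x).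
- apply: (zero (fun y => p_map (of_coords (lsubmx y)))).
    by move=> a; exact: qpolyfun_p_map.
  by move=> y [[]].
- split; first by apply/witt_algebraP; exists (rsubmx x).
  apply: (zero (fun y => p_map (of_coords (rsubmx y)))).
    by move=> a; exact: qpolyfun_p_map.
  by move=> y [_ []].
apply: (zero (fun y => bracket (of_coords (lsubmx y)) (of_coords (rsubmx y)))).
  by move=> a; exact: qpolyfun_bracket.
by move=> y [].
Qed.

End Coordinates.

End WittAlgebra.

(* Main.v *)
Require Import Defs.
From mathcomp Require Import all_boot all_order all_algebra.
From mathcomp Require Import mpoly.
From mathcomp Require Import ring.

Import GRing.Theory.
Local Open Scope ring_scope.
Local Open Scope quotient_scope.

(** The variety C(N) is reducible, and all of its components pass through the
    origin because it is a cone; so its local ring at 0 is not even a domain.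

    Reducibility is seen on two explicit functions.  Write a pair as
    x = sum_i a_i X^i D, y = sum_i b_i X^i D.  If a_0 <> 0, then the
    coefficient u of x = u D is a unit of k[X]/(X^p), and for y = v D the
    relation [x, y] = 0 says that the Wronskian u v' - v u' vanishes, that is
    (v / u)' = 0.  A polynomial of degree < p with zero derivative is constant
    in characteristic p, so y is a multiple of x ([commuting_proportional]).
    Hence
      a_0 * (a_2 b_(p-1) - a_(p-1) b_2) = 0  on C(N).
    Neither factor vanishes on C(N): the first is 1 at (D, 0), the second is 1
    at (X^2 D, X^(p-1) D), a commuting pair of nilpotent derivations; the
    indices 2 and p - 1 differ as p > 3.

    If the local ring at 0 were a domain, one of the two factors would be
    killed on C(N) by some h with h(0) <> 0 ([local_ring_domain]).  Both factors
    are homogeneous and C(N) is stable under scaling, so that factor would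
    vanish on all of C(N) ([cone_vanishing]). *)

(** * Zero divisors in local rings of affine varieties *)

Lemma pi_coord0 (k : fieldType) (n : nat) (V : 'rV[k]_n -> Prop) :
  \pi_(coord_ring V) 0 = 0.
Proof. by rewrite !piE. Qed.

Lemma pi_coordM (k : fieldType) (n : nat) (V : 'rV[k]_n -> Prop)
    (f g : {mpoly k[n]}) :
  \pi_(coord_ring V) f * \pi_(coord_ring V) g = \pi_(coord_ring V) (f * g).
Proof. by rewrite !piE. Qed.

Lemma pi_coord_eq0 (k : fieldType) (n : nat) (V : 'rV[k]_n -> Prop)
    (f : {mpoly k[n]}) :
  \pi_(coord_ring V) f = 0 <-> f \in vanishing V.
Proof.
rewrite -pi_coord0.
by split=> [/pi_coordP|e]; [|apply/pi_coordP]; rewrite subr0.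
Qed.

Lemma pi_loc_eq0 (R : comPzRingType) (F : fieldType) (phi : {rmorphism R -> F})
    (x : prefrac phi) :
  \pi_(localization phi) x = 0 <-> exists2 u, phi u != 0 & u * x.1 = 0.
Proof.
have -> : 0 = \pi_(localization phi) (cst_pre phi 0).
  by rewrite [LHS]/GRing.zero /= !piE.
split=> [/pi_locP/equiv_locP[u [u0]]|[u u0 ux]] /=.
  by rewrite mulr1 mul0r subr0; exists u.
by apply/pi_locP/equiv_locP; exists u; rewrite /= mulr1 mul0r subr0.
Qed.

Lemma pi_locM (R : comPzRingType) (F : fieldType) (phi : {rmorphism R -> F})
    (x y : prefrac phi) :
  \pi_(localization phi) x * \pi_(localization phi) y =
  \pi_(localization phi) (mul_pre x y).
Proof. by rewrite [LHS]/GRing.mul /= !piE. Qed.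

(** The form in which the theorem uses normality: a relation f g = 0 on V
    already holds factorwise near every point, with h cutting out the
    neighbourhood. *)
Lemma local_ring_domain (k : fieldType) (n : nat) (V : 'rV[k]_n -> Prop)
    (x : {x | V x}) (f g : {mpoly k[n]}) :
  integrally_closed_domain (local_ring x) -> f * g \in vanishing V ->
  exists2 h, evalp (sval x) h != 0 &
    h * f \in vanishing V \/ h * g \in vanishing V.
Proof.
move=> [R [phi [phi_bij _]]] fg0.
pose loc q : local_ring x :=
  \pi_(local_ring x) (cst_pre (coord_eval x) (\pi_(coord_ring V) q)).
have loc_eq0 q : loc q = 0 ->
    exists2 h, evalp (sval x) h != 0 & h * q \in vanishing V.
  move=> /pi_loc_eq0[u]; elim/quotW: u => h h0 /=.
  rewrite pi_coordM => /pi_coord_eq0 hq; exists h => //.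
  by rewrite -(coord_eval_pi x).
have loc_fg : loc f * loc g = 0.
  rewrite /loc pi_locM; apply/pi_loc_eq0; exists 1.
    by rewrite rmorph1 oner_neq0.
  by rewrite mul1r /= pi_coordM; apply/pi_coord_eq0.
have phi_eq0 a : phi a = 0 -> a = 0.
  by move=> a0; apply: (bij_inj phi_bij); rewrite a0 rmorph0.
have /eqP := congr1 phi loc_fg; rewrite rmorphM rmorph0 mulf_eq0.
case/orP => /eqP/phi_eq0/loc_eq0[h h0 hq]; exists h => //.
  by left.
by right.
Qed.

(** * Local vanishing at the vertex of a cone *)

(** If f(v) <> 0 for some v in V, then h vanishes at t v for all t <> 0, since
    f(t v) = t^d f(v) <> 0.  But t |-> h(t v) is a polynomial over an infinite
    field, so it also vanishes at t = 0, and h(0) = 0. *)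
Lemma cone_vanishing (k : closedFieldType) (n : nat) (V : 'rV[k]_n -> Prop)
    (h f : {mpoly k[n]}) (d : nat) :
  (forall t v, V v -> V (t *: v)) ->
  (forall t v, evalp (t *: v) f = t ^+ d * evalp v f) ->
  evalp 0 h != 0 -> h * f \in vanishing V -> f \in vanishing V.
Proof.
move=> cone fZ h0 /vanishingP hf0; apply/vanishingP => v Vv.
apply/eqP; apply: contraT => fv0.
pose q : {poly k} := mmap polyC (fun i => v 0 i *: 'X) h.
have qE t : q.[t] = evalp (t *: v) h.
  rewrite /q [h]mpolyE !raddf_sum /= /evalp raddf_sum horner_sum.
  apply: eq_bigr => m _; rewrite mmapZ /= mevalZ hornerCM.
  congr (_ * _).
  rewrite mmapX /mmap1 mevalX horner_prod; apply: eq_bigr => i _.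
  by rewrite horner_exp hornerZ hornerX mxE mulrC.
have q0 : q != 0.
  by apply: contraNneq h0 => q0; rewrite -(scale0r v) -qE q0 horner0.
(* Algebraic closedness gives a root t of X q + 1; it satisfies t <> 0 and
   q(t) <> 0, hence h(t v) <> 0. *)
have : size ('X * q + 1) != 1%N.
  rewrite size_polyDl ?size_poly1 mulrC size_mulX ?eqSS ?ltnS ?size_poly_gt0 //.
  by rewrite size_poly_eq0.
case/closed_rootP => t; rewrite rootE !hornerE qE.
have [->|t0] := eqVneq t 0; first by rewrite mul0r add0r oner_eq0.
have /eqP := hf0 _ (cone t v Vv).
rewrite evalpM fZ !mulf_eq0 expf_eq0 (negPf t0) (negPf fv0) andbF !orbF.
by move=> /eqP->; rewrite mulr0 add0r oner_eq0.
Qed.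

(** * Commuting derivations of k[X]/(X^p) *)

Section Witt.
Variables (k : fieldType) (p : nat) (pchar_k : p \in [pchar k]).
Local Notation A := (truncated_poly k p).
Local Notation X := ('qX : A).
Local Notation Df := (@Dfun k p).

Lemma bracket_of_coordsE (u v : 'rV[k]_p) (a : A) :
  bracket (of_coords u) (of_coords v) a =
  ((\sum_(i < p) u 0 i *: X ^+ i) * Df (\sum_(i < p) v 0 i *: X ^+ i)
   - (\sum_(i < p) v 0 i *: X ^+ i) * Df (\sum_(i < p) u 0 i *: X ^+ i))
  * Df a.
Proof.
rewrite /bracket add_lfunE opp_lfunE !comp_lfunE !of_coordsE.
by rewrite !(Dfun_leibniz pchar_k); ring.
Qed.

(** A representative z has degree < p, so the factors i + 1 by which its
    coefficients z_(i+1) get multiplied in z' are invertible in k. *)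
Lemma Dfun_eq0 (z : A) : Df z = 0 -> z = (z : {poly k})`_0 *: 1.
Proof.
have p_gt0 : (0 < p)%N := prime_gt0 (pcharf_prime pchar_k).
have le_zp : (size (z : {poly k}) <= p)%N.
  by rewrite -[X in (_ <= X)%N](size_mk_monicXp pchar_k) size_npoly.
move=> /(congr1 (fun a : A => a : {poly k})).
rewrite /Dfun (val_in_qpoly pchar_k) modp_small; last first.
  rewrite size_polyXn ltnS (leq_trans (size_poly _ _)) //.
  exact: leq_trans (leq_pred _) le_zp.
move=> dz; apply/val_inj; rewrite [RHS]poly_of_qpolyZ -mul_polyC mulr1.
apply/polyP => -[|i]; rewrite coefC //=.
have [lt_ip|le_pi] := ltnP i.+1 p; last first.
  by rewrite nth_default ?(leq_trans le_zp).
have := congr1 (fun q : {poly k} => q`_i) dz.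
rewrite coef_deriv coef0 -mulr_natr => /eqP; rewrite mulf_eq0 => /orP[/eqP //|].
by rewrite -(dvdn_pcharf pchar_k) gtnNdvd.
Qed.

Lemma Dfun1 : Df 1 = 0.
Proof.
by rewrite -(in_qpoly1 'X^p) (Dfun_in_qpoly pchar_k) derivC in_qpoly0.
Qed.

Lemma unit_truncated_poly (u : A) :
  (u : {poly k})`_0 != 0 -> u \is a GRing.unit.
Proof.
move=> u0; suff: coprimep (mk_monic ('X^p : {poly k})) (u : {poly k}) by [].
move: (u : {poly k}) u0 => q q0; rewrite (mk_monicXp pchar_k).
rewrite coprimep_expl // coprimep_sym coprimepX.
by rewrite rootE horner_coef0.
Qed.

(** The quotient v / u has derivative (u v' - v u') / u^2 = 0, so it is a
    constant. *)
Lemma proportional_of_wronskian (u v : A) :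
  (u : {poly k})`_0 != 0 -> u * Df v = v * Df u -> exists c, v = c *: u.
Proof.
move=> /unit_truncated_poly uu e.
have eu : Df u^-1 * u + u^-1 * Df u = 0.
  by rewrite -(Dfun_leibniz pchar_k) mulVr // Dfun1.
have /Dfun_eq0 cst : Df (u^-1 * v) = 0.
  apply: (mulrI uu); rewrite mulr0 (Dfun_leibniz pchar_k).
  have -> : u * (Df u^-1 * v + u^-1 * Df v) =
    v * (Df u^-1 * u) + u^-1 * (u * Df v) by ring.
  by rewrite e -(mulr0 v) -eu; ring.
exists ((u^-1 * v : A) : {poly k})`_0.
by rewrite -[LHS](mulVKr uu) [X in u * X]cst -scalerAr mulr1.
Qed.

(** A derivation u D with u(0) <> 0 has only its multiples as centralizer in
    W_1: bracketing u D with v D and applying the result to X gives the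
    Wronskian of u and v. *)
Lemma commuting_proportional (u v : 'rV[k]_p) (i0 : 'I_p) :
  i0 = 0%N :> nat -> u 0 i0 != 0 ->
  bracket (of_coords u) (of_coords v) = 0 -> exists c, v = c *: u.
Proof.
move=> i00 u0 /(congr1 (fun d : 'End(A) => d X)).
rewrite bracket_of_coordsE (DfunX pchar_k) mulr1 lfunE /= => /eqP.
rewrite subr_eq0 => /eqP /proportional_of_wronskian[|c e].
  by rewrite -[X in _`_X]i00 coef_qX_sum.
exists c; apply/rowP => j; rewrite mxE -!(coef_qX_sum pchar_k) e.
by rewrite poly_of_qpolyZ coefZ.
Qed.

(** * Points of the nilpotent commuting variety *)

Lemma p_mapZ (t : k) (d : 'End(A)) : p_map (t *: d) = t ^+ p *: p_map d.
Proof.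
suff iterZ m : iter m (comp_lfun (t *: d)) \1%VF =
    t ^+ m *: iter m (comp_lfun d) \1%VF by exact: iterZ.
elim: m => [|m IH] /=; first by rewrite scale1r.
by rewrite IH -comp_lfunZl -comp_lfunZr scalerA exprS.
Qed.

Lemma of_coordsZ (t : k) (u : 'rV[k]_p) :
  of_coords (t *: u) = t *: of_coords u.
Proof.
by rewrite /of_coords scaler_sumr; apply: eq_bigr => i _; rewrite mxE scalerA.
Qed.

Lemma of_coords_delta (i : 'I_p) : of_coords (delta_mx 0 i) = XD k p i.
Proof.
rewrite /of_coords (bigD1 i) //= mxE !eqxx scale1r big1 ?addr0 // => j ji.
by rewrite mxE (negPf ji) andbF scale0r.
Qed.

Lemma nilpotent_commuting_locus_cone (t : k) (v : 'rV[k]_(p + p)) :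
  nilpotent_commuting_locus v -> nilpotent_commuting_locus (t *: v).
Proof.
have lZ : lsubmx (t *: v) = t *: lsubmx v by apply/rowP => i; rewrite !mxE.
have rZ : rsubmx (t *: v) = t *: rsubmx v by apply/rowP => i; rewrite !mxE.
move=> [[_ xp] [_ yp] xy]; split; rewrite /= ?lZ ?rZ.
- split; first by apply/(witt_algebraP pchar_k); eexists.
  by rewrite of_coordsZ p_mapZ xp scaler0.
- split; first by apply/(witt_algebraP pchar_k); eexists.
  by rewrite of_coordsZ p_mapZ yp scaler0.
- move: xy; rewrite /bracket /= !of_coordsZ -!comp_lfunZl -!comp_lfunZr.
  rewrite !scalerA.
  by rewrite -scalerBr => ->; rewrite scaler0.
Qed.

Lemma XDE (i : nat) (a : A) : XD k p i a = X ^+ i * Df a.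
Proof. by rewrite lfunE. Qed.

Lemma p_map_XD0 : p_map (XD k p 0) = 0.
Proof.
apply/lfunP => a; rewrite /p_map lfunE /=.
have it m : iter m (fun e => (XD k p 0 \o e)%VF) \1%VF a =
    in_qpoly 'X^p (a : {poly k})^`(m).
  elim: m => [|m IH] /=; first by rewrite id_lfunE in_qpolyK.
  rewrite comp_lfunE IH XDE expr0 mul1r.
  by rewrite (Dfun_in_qpoly pchar_k).
rewrite it derivn_poly0 ?in_qpoly0 //.
by rewrite -[X in (_ <= X)%N](size_mk_monicXp pchar_k) size_npoly.
Qed.

Lemma DfunXn (m : nat) : Df (X ^+ m) = X ^+ m.-1 *+ m.
Proof.
rewrite -rmorphXn (Dfun_in_qpoly pchar_k) derivXn raddfMn /=.
by rewrite -rmorphXn.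
Qed.

Lemma qXp_eq0 : X ^+ p = 0.
Proof.
rewrite -rmorphXn; apply/val_inj.
by apply: etrans (val_in_qpoly pchar_k _) (modpp _).
Qed.

(** For i > 1, X^i D maps X^m k[X]/(X^p) into X^(m+1) k[X]/(X^p). *)
Lemma p_map_XD_ge2 (i : nat) : (1 < i)%N -> p_map (XD k p i) = 0.
Proof.
case: i => [|[|i]] // _.
apply/lfunP => a; rewrite /p_map lfunE /=.
have it m : exists b,
    iter m (fun e => (XD k p i.+2 \o e)%VF) \1%VF a = X ^+ m * b.
  elim: m => [|m [b IH]]; first by exists a; rewrite id_lfunE mul1r.
  exists (X ^+ i * (b *+ m + X * Df b)).
  rewrite /= comp_lfunE IH XDE (Dfun_leibniz pchar_k) DfunXn.
  case: m {IH} => [|m]; first by rewrite !mulr0n !exprS; ring.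
  rewrite -[X ^+ m *+ _]mulr_natr -[b *+ _]mulr_natr !exprS.
  move: (m.+1%:R) => c; ring.
by have [b ->] := it p; rewrite qXp_eq0 mul0r.
Qed.

(** [X^i D, X^j D] = (j - i) X^(i+j-1) D, and X^(i+j-1) = 0 if i + j > p. *)
Lemma bracket_XD (i j : nat) : (0 < i)%N -> (0 < j)%N -> (p < i + j)%N ->
  bracket (XD k p i) (XD k p j) = 0.
Proof.
move=> i0 j0 lt_p; apply/lfunP => a.
rewrite /bracket add_lfunE opp_lfunE !comp_lfunE !XDE lfunE /=.
rewrite !(Dfun_leibniz pchar_k) !DfunXn.
(* As j.-1 + i = i.-1 + j for positive i and j, these are the same power of X,
   coming from the two halves of the bracket. *)
have X0 : X ^+ (i + j.-1) = 0.
  have le_p : (p <= i + j.-1)%N by case: j j0 lt_p => // j; rewrite addnS.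
  by rewrite -(subnK le_p) exprD qXp_eq0 mulr0.
have X0' : X ^+ (j + i.-1) = 0.
  rewrite -X0; congr (_ ^+ _).
  case: i i0 {lt_p X0} => // i _; case: j j0 => // j _.
  by rewrite /= !addSn addnC.
rewrite !mulrDr !mulrA !mulrnAr -!exprD X0 X0'.
by rewrite !mul0rn !mul0r !add0r (addnC j) subrr.
Qed.

End Witt.

(** * Non-normality *)

Theorem corollary3p7 (k : closedFieldType) (p : nat)
    (pchar_k : p \in [pchar k]) (p_gt3 : (3 < p)%N) :
  ~ normal_variety (@nilpotent_commuting_locus k p).
Proof.
have p_gt0 : (0 < p)%N := ltn_trans (isT : (0 < 3)%N) p_gt3.
have p_gt2 : (2 < p)%N := ltn_trans (isT : (2 < 3)%N) p_gt3.
have p1_lt : (p.-1 < p)%N by rewrite prednK.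
pose i0 := Ordinal p_gt0; pose i2 := Ordinal p_gt2; pose im := Ordinal p1_lt.
set V := @nilpotent_commuting_locus k p => normV.
have XD_witt (i : 'I_p) : witt_algebra (XD k p i).
  by rewrite -of_coords_delta; apply/(witt_algebraP pchar_k); eexists.
pose v1 : 'rV[k]_(p + p) := row_mx (delta_mx 0 i0) 0.
pose v2 : 'rV[k]_(p + p) := row_mx (delta_mx 0 i2) (delta_mx 0 im).
have of_coords0 : of_coords (0 : 'rV[k]_p) = 0.
  by rewrite -(scale0r 0) of_coordsZ scale0r.
have Vv1 : V v1.
  split; rewrite /= ?row_mxKl ?row_mxKr ?of_coords_delta ?of_coords0.
  - by split; [exact: XD_witt | exact: p_map_XD0].
  - split; first by move=> a b; rewrite !lfunE /= mul0r mulr0 addr0.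
    by rewrite -[X in p_map X](scale0r 0) p_mapZ expr0n gtn_eqF // scale0r.
  - by rewrite /bracket comp_lfun0l comp_lfun0r subrr.
have Vv2 : V v2.
  split; rewrite /= ?row_mxKl ?row_mxKr ?of_coords_delta.
  - by split; [exact: XD_witt | apply: p_map_XD_ge2].
  - split; [exact: XD_witt | apply: p_map_XD_ge2 => //=].
    by rewrite ltn_predRL.
  - apply: bracket_XD => //=; first by rewrite ltn_predRL ltnW.
    by rewrite !addSn add0n prednK.
have V0 : V 0 by rewrite -(scale0r v1); apply: nilpotent_commuting_locus_cone.
pose a i : {mpoly k[p + p]} := 'X_(lshift p i).
pose b i : {mpoly k[p + p]} := 'X_(rshift p i).
pose f := a i0; pose g := a i2 * b im - a im * b i2.
have evala x i : evalp x (a i) = lsubmx x 0 i.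
  by rewrite /evalp mevalXU mxE.
have evalb x i : evalp x (b i) = rsubmx x 0 i.
  by rewrite /evalp mevalXU mxE.
(* Where a_0 <> 0, y = c x and g is a 2 x 2 minor of proportional rows. *)
have fg0 : f * g \in vanishing V.
  apply/vanishingP => x [_ _ xy].
  rewrite evalpM evalpB !evalpM !evala !evalb.
  have [->|x0] := eqVneq (lsubmx x 0 i0) 0; first by rewrite mul0r.
  have [c ->] := commuting_proportional _ _ pchar_k _ _ i0 erefl x0 xy.
  by rewrite !mxE; ring.
have [h h0 hfg] := local_ring_domain _ _ _ _ _ _ (normV (exist _ 0 V0)) fg0.
have cone t v : V v -> V (t *: v) :=
  nilpotent_commuting_locus_cone _ _ pchar_k t v.
case: hfg => hq.
  have /vanishingP/(_ _ Vv1) : f \in vanishing V.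
    apply: (@cone_vanishing _ _ _ h _ 1) => // t v.
    by rewrite !evala !mxE.
  by rewrite evala row_mxKl mxE !eqxx => /eqP; rewrite oner_eq0.
have /vanishingP/(_ _ Vv2) : g \in vanishing V.
  apply: (@cone_vanishing _ _ _ h _ 2) => // t v.
  by rewrite !evalpB !evalpM !evala !evalb !mxE; ring.
rewrite evalpB !evalpM !evala !evalb row_mxKl row_mxKr !mxE !eqxx /=.
have -> : (im == i2) = false.
  by apply/eqP => /(congr1 val) /= e; move: p_gt3; rewrite -(prednK p_gt0) e.
by rewrite mul0r subr0 mulr1 => /eqP; rewrite oner_eq0.
Qed.
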